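(* Let $(\mathcal{C},J)$ and $(\mathcal{D},K)$ be sites. For any comorphism of sites $f:(\mathcal{D},K)\to(\mathcal{C},J)$, the corepresentable distributor $\mathcal{C}(f,1):\mathcal{C}\looparrowright\mathcal{D}$, $(d,c)\mapsto\mathcal{C}(f(d),c)$, is a distributor of sites $(\mathcal{C},J)\looparrowright(\mathcal{D},K)$.
   Context: A site is a category with a Grothendieck topology. A comorphism of sites $f:(\mathcal{D},K)\to(\mathcal{C},J)$ is a functor such that for every $d$ in $\mathcal{D}$ and every $R\in J(f(d))$ the sieve $\{v:d'\to d\mid f(v)\in R\}$ is in $K(d)$. A distributor $H:\mathcal{C}\looparrowright\mathcal{D}$ is a functor $\mathcal{D}^{\mathrm{op}}\times\mathcal{C}\to\mathrm{Set}$. For a sieve $S$ on $c$ and $x\in H(d,c)$, $x^*H[S]$ is the sieve on $d$ of all $v:d'\to d$ such that there are $u:c'\to c$ in $S$ and $x'\in H(d',c')$ with $H(v,c)(x)=H(d',u)(x')$. $H$ is cover-distributing from $J$ to $K$ if $x^*H[S]\in K(d)$ for all $c,d$, $x\in H(d,c)$, $S\in J(c)$. $H$ is $K$-flat if: (1) for every $d$, the sieve $\{v:d'\to d\mid \exists c,\ H(d',c)\neq\emptyset\}$ is in $K(d)$; (2) for all $x\in H(d,c)$, $x'\in H(d,c')$, the sieve of all $v:d'\to d$ for which there exist $u:c''\to c$, $u':c''\to c'$, $x''\in H(d',c'')$ with $H(d',u)(x'')=H(v,c)(x)$ and $H(d',u')(x'')=H(v,c')(x')$ is in $K(d)$; (3)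 for all $u,u':c'\rightrightarrows c$ and $x\in H(d,c')$ with $H(d,u)(x)=H(d,u')(x)$, the sieve of all $v:d'\to d$ for which there exist $w:c''\to c'$ with $uw=u'w$ and $x'\in H(d',c'')$ with $H(d',w)(x')=H(v,c')(x)$ is in $K(d)$. $H$ is a distributor of sites $(\mathcal{C},J)\looparrowright(\mathcal{D},K)$ if it is cover-distributing from $J$ to $K$ and $K$-flat. *)

(* Defs.v *)
From Stdlib Require Import FunctionalExtensionality.

Set Implicit Arguments.
Unset Strict Implicit.
Unset Printing Implicit Defensive.

Declare Scope cat_scope.
Delimit Scope cat_scope with cat.
Local Open Scope cat_scope.

Record Category := {
  Ob :> Type;
  Hom : Ob -> Ob -> Type;
  idm : forall a, Hom a a;
  comp : forall a b c, Hom b c -> Hom a b -> Hom a c;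
  comp_idl : forall a b (f : Hom a b), comp (idm b) f = f;
  comp_idr : forall a b (f : Hom a b), comp f (idm a) = f;
  comp_assoc : forall a b c d (h : Hom c d) (g : Hom b c) (f : Hom a b),
    comp h (comp g f) = comp (comp h g) f
}.

Arguments Hom {C} a b : rename.
Arguments idm {C} a : rename.
Arguments comp {C a b c} g f : rename.
Arguments comp_idl {C a b} f : rename.
Arguments comp_idr {C a b} f : rename.
Arguments comp_assoc {C a b c d} h g f : rename.

Notation "g ∘ f" := (comp g f) (at level 40, left associativity) : cat_scope.

Record Functor (C D : Category) := {
  fobj :> C -> D;
  fmap : forall a b, Hom a b -> Hom (fobj a) (fobj b);
  fmap_id : forall a, fmap (idm a) = idm (fobj a);
  fmap_comp : forall a b c (g : Hom b c) (f : Hom a b),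
    fmap (g ∘ f) = fmap g ∘ fmap f
}.

Arguments fmap {C D} F {a b} f : rename.

Definition op_cat (C : Category) : Category := {|
  Ob := Ob C;
  Hom := fun a b => @Hom C b a;
  idm := fun a => @idm C a;
  comp := fun a b c g f => @comp C c b a f g;
  comp_idl := fun a b f => comp_idr f;
  comp_idr := fun a b f => comp_idl f;
  comp_assoc := fun a b c d h g f => eq_sym (@comp_assoc C d c b a f g h)
|}.

Definition prod_cat (C D : Category) : Category.
Proof.
refine {|
  Ob := Ob C * Ob D;
  Hom := fun a b => (Hom (fst a) (fst b) * Hom (snd a) (snd b))%type;
  idm := fun a => (idm (fst a), idm (snd a));
  comp := fun a b c g f => (fst g ∘ fst f, snd g ∘ snd f)
|}.
- intros a b [f g]; simpl; now rewrite !comp_idl.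
- intros a b [f g]; simpl; now rewrite !comp_idr.
- intros; simpl; now rewrite !comp_assoc.
Defined.

(* The category of sets, with the types of a universe in the role of sets. *)
Definition set_cat : Category := {|
  Ob := Type;
  Hom := fun A B => A -> B;
  idm := fun A x => x;
  comp := fun A B C g f x => g (f x);
  comp_idl := fun A B f => eq_refl;
  comp_idr := fun A B f => eq_refl;
  comp_assoc := fun A B C D h g f => eq_refl
|}.

Record Sieve (C : Category) (c : C) := {
  in_sieve :> forall c', Hom c' c -> Prop;
  sieve_closed : forall c' c'' (u : Hom c' c) (w : Hom c'' c'),
    in_sieve u -> in_sieve (u ∘ w)
}.

Arguments in_sieve {C c} S {c'} u : rename.
Arguments sieve_closed {C c} S {c' c''} u w _ : rename.

Definition max_sieve (C : Category) (c : C) : Sieve c := {|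
  in_sieve := fun _ _ => True;
  sieve_closed := fun _ _ _ _ _ => I
|}.

Definition pullback_sieve (C : Category) (b c : C) (f : Hom b c)
  (S : Sieve c) : Sieve b.
Proof.
refine {| in_sieve := fun b' (v : Hom b' b) => S b' (f ∘ v) |}.
intros b' b'' v w Hv; rewrite comp_assoc; now apply sieve_closed.
Defined.

Record Topology (C : Category) := {
  covers :> forall c : C, Sieve c -> Prop;
  covers_max : forall c : C, covers (max_sieve c);
  covers_pullback : forall (b c : C) (f : Hom b c) (S : Sieve c),
    covers S -> covers (pullback_sieve f S);
  covers_trans : forall (c : C) (S R : Sieve c), covers S ->
    (forall b (f : Hom b c), S b f -> covers (pullback_sieve f R)) ->
    covers R
}.

Arguments covers {C} J {c} S : rename.

Definition preimage_sieve (C D : Category) (f : Functor D C) (d : D)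
  (R : Sieve (f d)) : Sieve d.
Proof.
refine {| in_sieve := fun d' (v : Hom d' d) => R (f d') (fmap f v) |}.
intros d' d'' v w Hv; rewrite fmap_comp; now apply sieve_closed.
Defined.

Definition comorphism_of_sites (C D : Category) (K : Topology D)
  (J : Topology C) (f : Functor D C) : Prop :=
  forall (d : D) (R : Sieve (f d)), covers J R ->
    covers K (preimage_sieve R).

Definition Distributor (C D : Category) : Type :=
  Functor (prod_cat (op_cat D) C) set_cat.

Section Distributors.

Variables (C D : Category) (H : Distributor C D).

Definition dist (d : D) (c : C) : Type := H (d, c).

(* [lact v x] is H(v,c)(x) and [ract u x] is H(d,u)(x). *)
Definition lact (d d' : D) (c : C) (v : Hom d' d) (x : dist d c) :
    dist d' c :=
  @fmap _ _ H (d, c) (d', c) (v, idm c) x.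

Definition ract (d : D) (c c' : C) (u : Hom c c') (x : dist d c) :
    dist d c' :=
  @fmap _ _ H (d, c) (d, c') (@idm D d, u) x.

Lemma lact_comp (d d' d'' : D) (c : C) (v : Hom d' d) (w : Hom d'' d')
  (x : dist d c) : lact (v ∘ w) x = lact w (lact v x).
Proof.
pose proof (@fmap_comp _ _ H (d, c) (d', c) (d'', c) (w, idm c) (v, idm c))
  as E.
simpl in E; rewrite comp_idl in E.
exact (f_equal (fun g => g x) E).
Qed.

Lemma lact_ract (d d' : D) (c c' : C) (v : Hom d' d) (u : Hom c c')
  (x : dist d c) : lact v (ract u x) = ract u (lact v x).
Proof.
pose proof (@fmap_comp _ _ H (d, c) (d, c') (d', c')
  (v, idm c') (@idm D d, u)) as E1.
pose proof (@fmap_comp _ _ H (d, c) (d', c) (d', c')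
  (@idm D d', u) (v, idm c)) as E2.
simpl in E1, E2; rewrite !comp_idl in E1; rewrite !comp_idr in E2.
pose proof (eq_trans (eq_sym E1) E2) as E.
exact (f_equal (fun g => g x) E).
Qed.

Definition dist_sieve (c : C) (d : D) (x : dist d c) (S : Sieve c) :
  Sieve d.
Proof.
refine {| in_sieve := fun d' (v : Hom d' d) =>
  exists (c' : C) (u : Hom c' c) (x' : dist d' c'),
    S c' u /\ lact v x = ract u x' |}.
intros d' d'' v w (c' & u & x' & Su & E); exists c', u, (lact w x').
now rewrite lact_comp, E, lact_ract.
Defined.

Definition cover_distributing (J : Topology C) (K : Topology D) : Prop :=
  forall (c : C) (d : D) (x : dist d c) (S : Sieve c),
    covers J S -> covers K (dist_sieve x S).

Definition inhab_sieve (d : D) : Sieve d.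
Proof.
refine {| in_sieve := fun d' (_ : Hom d' d) =>
  exists c : C, inhabited (dist d' c) |}.
intros d' d'' v w (c & [x]); exists c; constructor; exact (lact w x).
Defined.

Definition span_sieve (d : D) (c c' : C) (x : dist d c) (x' : dist d c') :
  Sieve d.
Proof.
refine {| in_sieve := fun d' (v : Hom d' d) =>
  exists (c'' : C) (u : Hom c'' c) (u' : Hom c'' c') (x'' : dist d' c''),
    ract u x'' = lact v x /\ ract u' x'' = lact v x' |}.
intros d' d'' v w (c'' & u & u' & x'' & E & E').
exists c'', u, u', (lact w x'').
now rewrite !lact_comp, <- E, <- E', !lact_ract.
Defined.

Definition equalizing_sieve (d : D) (c c' : C) (u u' : Hom c' c)
  (x : dist d c') : Sieve d.
Proof.
refine {| in_sieve := fun d' (v : Hom d' d) =>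
  exists (c'' : C) (w : Hom c'' c') (x' : dist d' c''),
    u ∘ w = u' ∘ w /\ ract w x' = lact v x |}.
intros d' d'' v t (c'' & w & x' & E & E'); exists c'', w, (lact t x').
now rewrite lact_comp, <- E', lact_ract.
Defined.

Definition flat (K : Topology D) : Prop :=
  (forall d : D, covers K (inhab_sieve d)) /\
  (forall (d : D) (c c' : C) (x : dist d c) (x' : dist d c'),
     covers K (span_sieve x x')) /\
  (forall (d : D) (c c' : C) (u u' : Hom c' c) (x : dist d c'),
     ract u x = ract u' x -> covers K (equalizing_sieve u u' x)).

Definition distributor_of_sites (J : Topology C) (K : Topology D) : Prop :=
  cover_distributing J K /\ flat K.

End Distributors.

(* C(f,1) sends (v, u) : (d, c) -> (d', c') of D^op x C, i.e. v : d' -> d in D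
   and u : c -> c' in C, to the function x |-> u ∘ x ∘ f(v). *)
Definition corepresentable (C D : Category) (f : Functor D C) :
  Distributor C D.
Proof.
refine (@Build_Functor (prod_cat (op_cat D) C) set_cat
  (fun p => @Hom C (f (fst p)) (snd p))
  (fun p q m x => snd m ∘ x ∘ @fmap D C f (fst q) (fst p) (fst m)) _ _).
- intros [d c]; apply functional_extensionality; intros x; simpl.
  now rewrite fmap_id, comp_idl, comp_idr.
- intros [d c] [d' c'] [d'' c''] [v' u'] [v u].
  apply functional_extensionality; intros x; simpl.
  now rewrite fmap_comp, !comp_assoc.
Defined.

(* Main.v *)
Require Import Defs.
From Stdlib Require Import FunctionalExtensionality PropExtensionality ProofIrrelevance.

(** Every element [x : f d -> c] of C(f,1)(d, c) is obtained from the universal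
    element [idm (f d)] by the action of [x] itself.  Hence all the sieves in
    the flatness conditions are maximal, with witness [idm (f d')], while
    [x^*H[S]] contains the preimage under [f] of the pullback of [S] along
    [x], which is covering because [f] is a comorphism. *)

Set Implicit Arguments.
Unset Strict Implicit.
Unset Printing Implicit Defensive.

Local Open Scope cat_scope.

(* [Topology] does not assume invariance under extensional equality of sieves,
   so the equality with [max_sieve] has to be a Leibniz one. *)
Lemma total_sieve_eq_max (C : Category) (c : C) (S : Sieve c) :
  (forall c' (u : Hom c' c), S c' u) -> S = max_sieve c.
Proof.
destruct S as [P HP]; simpl; intros HS.
assert (E : P = fun _ _ => True).
{ apply functional_extensionality_dep; intros c'.
  apply functional_extensionality; intros u.
  apply propositional_extensionality; split; auto. }
subst P; unfold max_sieve; f_equal; apply proof_irrelevance.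
Qed.

Lemma covers_total (C : Category) (J : Topology C) (c : C) (S : Sieve c) :
  (forall c' (u : Hom c' c), S c' u) -> covers J S.
Proof. intros HS; rewrite (total_sieve_eq_max HS); apply covers_max. Qed.

(** By transitivity: the pullback of [R] along any member of [S] is total, since that member already
    lies in [R]. *)
Lemma covers_superset (C : Category) (J : Topology C) (c : C)
  (S R : Sieve c) :
  covers J S -> (forall c' (u : Hom c' c), S c' u -> R c' u) -> covers J R.
Proof.
intros HS HSR; apply (covers_trans HS); intros b f Sf.
apply covers_total; intros b' u; simpl.
apply sieve_closed, HSR, Sf.
Qed.

Section Corepresentable.

Variables (C D : Category) (f : Functor D C).

Let H : Distributor C D := corepresentable f.

Lemma corepresentable_lact (d d' : D) (c : C) (v : Hom d' d)
  (x : Hom (f d) c) : lact (H := H) v x = x ∘ fmap f v.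
Proof. unfold lact; simpl; now rewrite comp_idl. Qed.

Lemma corepresentable_ract (d : D) (c c' : C) (u : Hom c c')
  (x : Hom (f d) c) : ract (H := H) u x = u ∘ x.
Proof. unfold ract; simpl; now rewrite fmap_id, comp_idr. Qed.

(** Supplies the witness equation for the cover-distributing, span and equalizing sieves. *)
Lemma corepresentable_ract_id (d d' : D) (c : C) (v : Hom d' d)
  (x : Hom (f d) c) :
  ract (H := H) (x ∘ fmap f v) (idm (f d')) = lact (H := H) v x.
Proof. now rewrite corepresentable_ract, corepresentable_lact, comp_idr. Qed.

Lemma corepresentable_cover_distributing (J : Topology C) (K : Topology D) :
  comorphism_of_sites K J f -> cover_distributing H J K.
Proof.
intros hf c d x S HS.
apply (covers_superset (hf d _ (covers_pullback (x : Hom (f d) c) HS))).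
intros d' v Sv.
exists (f d'), ((x : Hom (f d) c) ∘ fmap f v), (idm (f d')); split.
(* Membership of [v] in the preimage of the pulled-back sieve unfolds to [x ∘ fmap f v] being in
   [S]. *)
- exact Sv.
- now rewrite corepresentable_ract_id.
Qed.

Lemma corepresentable_flat (K : Topology D) : flat H K.
Proof.
split; [|split].
- intros d; apply covers_total; intros d' v.
  exists (f d'); constructor; exact (idm (f d')).
- intros d c c' x x'; apply covers_total; intros d' v.
  (* The apex is [f d'], and the legs are the two restricted elements themselves. *)
  exists (f d'), ((x : Hom (f d) c) ∘ fmap f v),
    ((x' : Hom (f d) c') ∘ fmap f v), (idm (f d')).
  now rewrite !corepresentable_ract_id.
- intros d c c' u u' x E; apply covers_total; intros d' v.
  rewrite !corepresentable_ract in E.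
  exists (f d'), ((x : Hom (f d) c') ∘ fmap f v), (idm (f d')); split.
  (* [E] now says that [x] itself equalizes [u] and [u'], hence so does [x ∘ fmap f v]. *)
  + now rewrite !comp_assoc, E.
  + now rewrite corepresentable_ract_id.
Qed.

End Corepresentable.

Theorem lemma2p2p22 (C D : Category) (J : Topology C) (K : Topology D)
  (f : Functor D C) (hf : comorphism_of_sites K J f) :
  distributor_of_sites (corepresentable f) J K.
Proof.
split.
- now apply corepresentable_cover_distributing.
- apply corepresentable_flat.
Qed.
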